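(* Any Albert extension of $C_2$ by $C_3$ is isomorphic to one of the following loops $\mathcal{L}_{f}$ on $C_3\times C_2$: the loop $\mathcal{L}_{f_0}$, which is isomorphic to the cyclic group $C_6$; the loop $\mathcal{L}_{f_1}$, which is a commutative proper loop; the loop $\mathcal{L}_{f_2}$, which is a non-commutative proper loop. For each of these loops the normal subgroup $\{0\}\times C_2$ is nuclear.
   Context: $C_2=\{0,1\}$ and $C_3=\{0,1,2\}$ are the cyclic groups, written additively. For a function $f:C_3\times C_3\to C_2$ with $f(\alpha,0)=f(0,\beta)=0$ for all $\alpha,\beta$, $\mathcal{L}_f$ is the loop on $C_3\times C_2$ with multiplication $(\alpha,a)(\beta,b)=(\alpha+\beta,\,f(\alpha,\beta)+a+b)$. The functions are: $f_0\equiv 0$; $f_1(2,2)=1$ and $f_1=0$ at all other pairs; $f_2(2,1)=1$ and $f_2=0$ at all other pairs. A proper loop is a non-associative loop. A subloop is nuclear if all its elements lie in the nucleus, i.e. in the intersection of the left nucleus $\{u: ux\cdot y=u\cdot xy\ \forall x,y\}$, the middle nucleus $\{u: xu\cdot y=x\cdot uy\ \forall x,y\}$ and the right nucleus $\{u: xy\cdot u=x\cdot yu\ \forall x,y\}$. For loops $K,N$ with identities $\epsilon,e$, an Albert extension of $N$ by $K$ is a loop on $K\times N$ with multiplication $(\alpha,a)(\beta,b)=(\alpha\beta,\triangledown_{\alpha,\beta}(a,b))$, where $\triangledown_{\alpha,\beta}$ are quasigroup multiplications on $N$ such that $\triangledown_{\epsilon,\epsilon}$ is the multiplication of $N$, $e$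 is a left identity of $\triangledown_{\epsilon,\alpha}$ and $e$ is a two-sided identity of $\triangledown_{\alpha,\epsilon}$ for all $\alpha\in K$. Here $N=C_2$, $K=C_3$. *)

(* Defs.v *)
From mathcomp Require Import all_boot all_order all_algebra.

Set Implicit Arguments.
Unset Strict Implicit.
Unset Printing Implicit Defensive.

Import GRing.Theory.
Local Open Scope ring_scope.

Section Loops.
Variables (T : Type) (mul : T -> T -> T).

Definition quasigroup : Prop :=
  (forall a b, exists! x, mul a x = b) /\ (forall a b, exists! y, mul y a = b).

Definition loop (e : T) : Prop :=
  [/\ quasigroup, left_id e mul & right_id e mul].

Definition proper_loop (e : T) : Prop := loop e /\ ~ associative mul.

Definition left_nucleus (u : T) : Prop :=
  forall x y, mul (mul u x) y = mul u (mul x y).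

Definition middle_nucleus (u : T) : Prop :=
  forall x y, mul (mul x u) y = mul x (mul u y).

Definition right_nucleus (u : T) : Prop :=
  forall x y, mul (mul x y) u = mul x (mul y u).

Definition nucleus (u : T) : Prop :=
  [/\ left_nucleus u, middle_nucleus u & right_nucleus u].

End Loops.

Definition isomorphic (T U : Type) (mulT : T -> T -> T) (mulU : U -> U -> U) :
    Prop :=
  exists2 h : T -> U, bijective h & {morph h : x y / mulT x y >-> mulU x y}.

Section Subloops.
Variables (T : finType) (mul : T -> T -> T) (e : T).
Implicit Type S : {set T}.

(* The last two conditions are closure under left and right division. *)
Definition subloop S : Prop :=
  [/\ e \in S,
      forall x y, x \in S -> y \in S -> mul x y \in S,
      forall a x, a \in S -> mul a x \in S -> x \in S
    & forall a y, a \in S -> mul y a \in S -> y \in S].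

(* xS = Sx, x(yS) = (xy)S and (Sx)y = S(xy). *)
Definition normal_subloop S : Prop :=
  [/\ subloop S,
      forall x, [set mul x s | s in S] = [set mul s x | s in S],
      forall x y, [set mul x (mul y s) | s in S] = [set mul (mul x y) s | s in S]
    & forall x y, [set mul (mul s x) y | s in S] = [set mul s (mul x y) | s in S]].

Definition normal_subgroup S : Prop :=
  normal_subloop S /\ {in S & &, associative mul}.

Definition nuclear S : Prop :=
  subloop S /\ (forall u, u \in S -> nucleus mul u).

End Subloops.

(* [mul] is the multiplication on K * N of an Albert extension of the loop
   (N, mulN, eN) by the loop (K, mulK, eK). *)
Definition albert_extension (K N : Type)
    (mulK : K -> K -> K) (eK : K) (mulN : N -> N -> N) (eN : N)
    (mul : K * N -> K * N -> K * N) : Prop :=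
  [/\ loop mulK eK, loop mulN eN, loop mul (eK, eN)
    & exists tri : K -> K -> N -> N -> N,
      [/\ forall alpha beta, quasigroup (tri alpha beta),
          tri eK eK =2 mulN,
          forall alpha, left_id eN (tri eK alpha),
          forall alpha, left_id eN (tri alpha eK) /\ right_id eN (tri alpha eK)
        & forall alpha beta a b,
            mul (alpha, a) (beta, b) = (mulK alpha beta, tri alpha beta a b)]].

(* The cyclic groups C_2, C_3, C_6 are the additive groups of 'Z_2, 'Z_3, 'Z_6.
   [Lmul f] is a loop multiplication with identity (0, 0) as soon as
   f alpha 0 = f 0 beta = 0. *)
Definition Lmul (f : 'Z_3 -> 'Z_3 -> 'Z_2) (x y : 'Z_3 * 'Z_2) : 'Z_3 * 'Z_2 :=
  (x.1 + y.1, f x.1 y.1 + x.2 + y.2).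

Definition f0 (alpha beta : 'Z_3) : 'Z_2 := 0.

Definition f1 (alpha beta : 'Z_3) : 'Z_2 :=
  if (alpha == 2) && (beta == 2) then 1 else 0.

Definition f2 (alpha beta : 'Z_3) : 'Z_2 :=
  if (alpha == 2) && (beta == 1) then 1 else 0.

Definition zero_C2 : {set 'Z_3 * 'Z_2} := setX [set 0] [set: 'Z_2].

(* Main.v *)
(* A quasigroup operation on C_2 is necessarily (a, b) |-> c + a + b, so every
   Albert extension of C_2 by C_3 is L_f for a function f vanishing on both
   axes.  Adding to f the coboundary of phi with phi(1) = f(2,2) and
   phi(2) = f(1,1) does not change the isomorphism class of L_f and leaves
   f(1,2) + f(1,1) + f(2,2) and f(2,1) + f(1,1) + f(2,2) as the only
   invariants.  The automorphism -1 of C_3 exchanges these two values, which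
   leaves three classes.  The subgroup {0} x C_2 is always central. *)
Require Import Defs.
From mathcomp Require Import all_boot all_order all_algebra.
From mathcomp Require Import ring.
Import GRing.Theory.
Local Open Scope ring_scope.

Lemma Z2_ind (P : 'Z_2 -> Prop) : P 0 -> P 1 -> forall a, P a.
Proof.
move=> P0 P1 [[|[|//]] lt_a2].
  by rewrite (_ : Ordinal _ = 0) //; apply: val_inj.
by rewrite (_ : Ordinal _ = 1) //; apply: val_inj.
Qed.

Lemma Z3_ind (P : 'Z_3 -> Prop) : P 0 -> P 1 -> P 2 -> forall alpha, P alpha.
Proof.
move=> P0 P1 P2 [[|[|[|//]]] lt_a3].
- by rewrite (_ : Ordinal _ = 0) //; apply: val_inj.
- by rewrite (_ : Ordinal _ = 1) //; apply: val_inj.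
by rewrite (_ : Ordinal _ = 2) //; apply: val_inj.
Qed.

Lemma addZ2K (a : 'Z_2) : a + a = 0.
Proof. by elim/Z2_ind: a; apply: val_inj. Qed.

Lemma Z2_neq (a b : 'Z_2) : a <> b -> a = b + 1.
Proof.
by elim/Z2_ind: a; elim/Z2_ind: b => // _; apply: val_inj.
Qed.

(** Unique division makes each row and column of the table injective, and on two elements this means
    that changing one argument flips the value. *)
Lemma quasigroup_Z2 (q : 'Z_2 -> 'Z_2 -> 'Z_2) :
  quasigroup q -> forall a b, q a b = q 0 0 + a + b.
Proof.
case=> divl divr.
have q1 a : q a 1 = q a 0 + 1.
  apply: Z2_neq => eq_q; have [x [_ Ux]] := divl a (q a 0).
  by have := etrans (esym (Ux _ eq_q)) (Ux _ erefl).
have q10 : q 1 0 = q 0 0 + 1.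
  apply: Z2_neq => eq_q; have [x [_ Ux]] := divr 0 (q 0 0).
  by have := etrans (esym (Ux _ eq_q)) (Ux _ erefl).
by elim/Z2_ind => b; elim/Z2_ind: b; rewrite ?q1 ?q10 ?addr0.
Qed.

(** The isomorphism is [(alpha, a) |-> (s * alpha, phi alpha + a)]; the second hypothesis is its
    morphism law with [a] and [b] cancelled. *)
Lemma Lmul_isomorphic (f g : 'Z_3 -> 'Z_3 -> 'Z_2) (s : 'Z_3)
    (phi : 'Z_3 -> 'Z_2) :
  s * s = 1 ->
  (forall alpha beta, phi (alpha + beta) + f alpha beta =
     g (s * alpha) (s * beta) + phi alpha + phi beta) ->
  isomorphic (Lmul f) (Lmul g).
Proof.
move=> ss1 cobound; exists (fun x => (s * x.1, phi x.1 + x.2)).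
  (* Here [s] is its own inverse, and [phi] cancels itself in characteristic 2. *)
  exists (fun x => (s * x.1, phi (s * x.1) + x.2)) => -[alpha a] /=;
  by rewrite !mulrA ss1 !mul1r addrA addZ2K add0r.
move=> [alpha a] [beta b]; congr pair => /=; first by rewrite mulrDr.
by rewrite !addrA cobound; ring.
Qed.

Lemma eq_isomorphic (T U : Type) (mul mul' : T -> T -> T) (mulU : U -> U -> U) :
  mul =2 mul' -> isomorphic mul' mulU -> isomorphic mul mulU.
Proof. by move=> eq_mul [h bij_h hM]; exists h => // x y; rewrite eq_mul hM. Qed.

Lemma albert_extension_Lmul (mul : 'Z_3 * 'Z_2 -> 'Z_3 * 'Z_2 -> 'Z_3 * 'Z_2) :
  albert_extension (fun alpha beta : 'Z_3 => alpha + beta) 0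
                   (fun a b : 'Z_2 => a + b) 0 mul ->
  exists f, [/\ forall alpha, f alpha 0 = 0, forall beta, f 0 beta = 0
              & mul =2 Lmul f].
Proof.
case=> _ _ _ [tri [triQ _ tri0l tri0r mulE]].
(* The cocycle is the constant term of each quasigroup; it vanishes on the axes because [0] is a
   left identity there. *)
exists (fun alpha beta => tri alpha beta 0 0); split=> [alpha|beta|].
- by case: (tri0r alpha).
- exact: tri0l.
by move=> [alpha a] [beta b]; rewrite mulE (quasigroup_Z2 _ (triQ alpha beta)).
Qed.

(* The automorphism of C_3 is multiplication by s, and (0, p, q) is the table of
   the cochain phi. *)
Lemma Lmul_isomorphic_table (f g : 'Z_3 -> 'Z_3 -> 'Z_2) (s : 'Z_3)
    (p q : 'Z_2) :
  (forall alpha, f alpha 0 = 0) -> (forall beta, f 0 beta = 0) ->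
  (forall alpha, g alpha 0 = 0) -> (forall beta, g 0 beta = 0) ->
  s * s = 1 ->
  q + f 1 1 = g s s + p + p -> p + f 2 2 = g (s * 2) (s * 2) + q + q ->
  f 1 2 = g s (s * 2) + p + q -> f 2 1 = g (s * 2) s + q + p ->
  isomorphic (Lmul f) (Lmul g).
Proof.
move=> fr fl gr gl ss1 f11 f22 f12 f21.
pose phi alpha := if alpha == 1 :> 'Z_3 then p else if alpha == 2 then q else 0.
have phi0 : phi 0 = 0 by [].
have phi1 : phi 1 = p by [].
have phi2 : phi 2 = q by [].
apply: (Lmul_isomorphic f g s phi ss1).
have d11 : 1 + 1 = 2 :> 'Z_3 by apply: val_inj.
have d12 : 1 + 2 = 0 :> 'Z_3 by apply: val_inj.
have d21 : 2 + 1 = 0 :> 'Z_3 by apply: val_inj.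
have d22 : 2 + 2 = 1 :> 'Z_3 by apply: val_inj.
(* Normalization settles the five pairs with a zero entry; the other four are the hypotheses. *)
by do 2!elim/Z3_ind; rewrite ?mulr0 ?mulr1 ?addr0 ?add0r ?(d11, d12, d21, d22)
  ?(fr, fl, gr, gl) ?(phi0, phi1, phi2) ?addr0 ?add0r.
Qed.

Lemma f0_normalized :
  (forall alpha, f0 alpha 0 = 0) /\ (forall beta, f0 0 beta = 0).
Proof. by []. Qed.

Lemma f1_normalized :
  (forall alpha, f1 alpha 0 = 0) /\ (forall beta, f1 0 beta = 0).
Proof. by split=> // alpha; rewrite /f1 andbF. Qed.

Lemma f2_normalized :
  (forall alpha, f2 alpha 0 = 0) /\ (forall beta, f2 0 beta = 0).
Proof. by split=> // alpha; rewrite /f2 andbF. Qed.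

Lemma Lmul_classification (f : 'Z_3 -> 'Z_3 -> 'Z_2) :
  (forall alpha, f alpha 0 = 0) -> (forall beta, f 0 beta = 0) ->
  [\/ isomorphic (Lmul f) (Lmul f0), isomorphic (Lmul f) (Lmul f1)
    | isomorphic (Lmul f) (Lmul f2)].
Proof.
move=> fr fl.
have [[f0r f0l] [f1r f1l] [f2r f2l]] :=
  And3 f0_normalized f1_normalized f2_normalized.
have iso0 := Lmul_isomorphic_table f f0 1 (f 2 2) (f 1 1) fr fl f0r f0l.
(* The extra [1] compensates for [f1 2 2 = 1]. *)
have iso1 := Lmul_isomorphic_table f f1 1 (f 2 2 + 1) (f 1 1) fr fl f1r f1l.
have iso2 s := Lmul_isomorphic_table f f2 s (f 2 2) (f 1 1) fr fl f2r f2l.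
(* When exactly one invariant is 1, [s = 1] serves if it is the one at [(2, 1)], and [s = 2], that
   is -1, if it is the one at [(1, 2)]. *)
have iso2' := iso2 2; move: iso0 iso1 {iso2}(iso2 1) iso2'.
elim/Z2_ind: (f 1 1); elim/Z2_ind: (f 2 2);
  elim/Z2_ind: (f 1 2); elim/Z2_ind: (f 2 1) => iso0 iso1 iso2 iso2';
  first [ by constructor 1; apply: iso0; apply: val_inj
        | by constructor 2; apply: iso1; apply: val_inj
        | by constructor 3; apply: iso2; apply: val_inj
        | by constructor 3; apply: iso2'; apply: val_inj ].
Qed.

Section NormalizedLmul.
Variable f : 'Z_3 -> 'Z_3 -> 'Z_2.
Hypotheses (fr : forall alpha, f alpha 0 = 0) (fl : forall beta, f 0 beta = 0).

Lemma Lmul_loop : loop (Lmul f) (0, 0).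
Proof.
split; first split.
- move=> [alpha a] [beta b].
  exists (beta - alpha, b - f alpha (beta - alpha) - a); split.
    by congr pair => /=; ring.
  by move=> [gamma c] [<- <-]; congr pair => /=;
    rewrite ?[alpha + gamma]addrC ?addrK //; ring.
- move=> [alpha a] [beta b].
  exists (beta - alpha, b - f (beta - alpha) alpha - a); split.
    by congr pair => /=; ring.
  by move=> [gamma c] [<- <-]; congr pair => /=; rewrite ?addrK //; ring.
- by move=> [alpha a]; rewrite /Lmul /= fl !add0r.
by move=> [alpha a]; rewrite /Lmul /= fr !addr0 add0r.
Qed.

Lemma mem_zero_C2 x : (x \in zero_C2) = (x.1 == 0).
Proof. by rewrite !inE andbT. Qed.

Lemma Lmul_nuclear : nuclear (Lmul f) (0, 0) zero_C2.
Proof.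
split.
  split=> [|x y|x y|x y]; rewrite !mem_zero_C2 //=.
  - by move=> /eqP-> /eqP->; rewrite addr0.
  - by move=> /eqP->; rewrite add0r.
  by move=> /eqP->; rewrite addr0.
move=> [alpha a]; rewrite mem_zero_C2 /= => /eqP->.
(* Every value of [f] with an argument from the nuclear element vanishes, so both sides keep only
   [f beta gamma]. *)
by split=> -[beta b] [gamma c]; congr pair => /=;
  rewrite ?fl ?fr ?add0r ?addr0 ?fl ?fr //; ring.
Qed.

Lemma Lmul_zero_C2C x s : s \in zero_C2 -> Lmul f x s = Lmul f s x.
Proof.
case: x s => [alpha a] [beta b]; rewrite mem_zero_C2 /= => /eqP->.
by congr pair => /=; rewrite ?fl ?fr; ring.
Qed.

Lemma Lmul_normal_subgroup : normal_subgroup (Lmul f) (0, 0) zero_C2.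
Proof.
have [subS nucS] := Lmul_nuclear.
split; last by move=> x y z /nucS[assocx _ _] _ _; rewrite assocx.
(* The coset equalities hold element by element, by centrality and by the right and left nucleus
   laws. *)
split=> // [x|x y|x y]; apply: eq_in_imset => s Ss.
- exact: Lmul_zero_C2C.
- by have [_ _ ->] := nucS s Ss.
by have [-> _ _] := nucS s Ss.
Qed.

End NormalizedLmul.

Lemma Lmul_f0_Z6 : isomorphic (Lmul f0) (fun i j : 'Z_6 => i + j).
Proof.
(* 4 and 3 are the idempotents of Z/6 that split it as Z/3 x Z/2. *)
exists (fun x : 'Z_3 * 'Z_2 => 4 * (x.1 : nat)%:R + 3 * (x.2 : nat)%:R).
  (* The inverse reduces modulo 3 and modulo 2. *)
  exists (fun i : 'Z_6 => ((i : nat)%:R, (i : nat)%:R)).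
    case=> alpha; elim/Z3_ind: alpha; elim/Z2_ind;
    by congr pair; apply: val_inj.
  by case=> [[|[|[|[|[|[|//]]]]]] lt_i6]; apply: val_inj.
by move=> [alpha a] [beta b]; elim/Z3_ind: alpha; elim/Z3_ind: beta;
  elim/Z2_ind: a; elim/Z2_ind: b; apply: val_inj.
Qed.

Theorem proposition14 :
  (forall mul : 'Z_3 * 'Z_2 -> 'Z_3 * 'Z_2 -> 'Z_3 * 'Z_2,
     albert_extension (fun alpha beta : 'Z_3 => alpha + beta) 0
                      (fun a b : 'Z_2 => a + b) 0 mul ->
     [\/ isomorphic mul (Lmul f0), isomorphic mul (Lmul f1)
       | isomorphic mul (Lmul f2)]) /\
  (loop (Lmul f0) (0, 0) /\
   isomorphic (Lmul f0) (fun i j : 'Z_6 => i + j)) /\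
  (proper_loop (Lmul f1) (0, 0) /\ commutative (Lmul f1)) /\
  (proper_loop (Lmul f2) (0, 0) /\ ~ commutative (Lmul f2)) /\
  (normal_subgroup (Lmul f0) (0, 0) zero_C2 /\ nuclear (Lmul f0) (0, 0) zero_C2) /\
  (normal_subgroup (Lmul f1) (0, 0) zero_C2 /\ nuclear (Lmul f1) (0, 0) zero_C2) /\
  (normal_subgroup (Lmul f2) (0, 0) zero_C2 /\ nuclear (Lmul f2) (0, 0) zero_C2).
Proof.
have [[f0r f0l] [f1r f1l] [f2r f2l]] :=
  And3 f0_normalized f1_normalized f2_normalized.
split.
  move=> mul /albert_extension_Lmul[f [fr fl mulE]].
  by case: (Lmul_classification f fr fl) => iso_f;
    [constructor 1 | constructor 2 | constructor 3]; apply: eq_isomorphic iso_f.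
split; first by split; [exact: Lmul_loop | exact: Lmul_f0_Z6].
split.
  split; last first.
    move=> [alpha a] [beta b]; rewrite /Lmul /f1 /= andbC.
    by congr pair; ring.
  split; first exact: Lmul_loop.
  (* Only the bracketing [(1 + 1) + 2] meets the pair [(2, 2)]. *)
  by move/(_ (1, 0) (1, 0) (2, 0))/eqP.
split.
  split; last by move/(_ (1, 0) (2, 0))/eqP.
  split; first exact: Lmul_loop.
  (* Only the bracketing [(1 + 1) + 1] meets the pair [(2, 1)]. *)
  by move/(_ (1, 0) (1, 0) (1, 0))/eqP.
by do 2![split;
    first by split; [exact: Lmul_normal_subgroup | exact: Lmul_nuclear]];
  split; [exact: Lmul_normal_subgroup | exact: Lmul_nuclear].
Qed.
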